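(* Let $0<b<1$. Then the set $$\{\lambda\in(0,1): (\lambda,b)\in\mathcal{E}\}$$ has Hausdorff dimension zero, where $\mathcal{E}=\{(\lambda,b): 0<1-\lambda<b<1 \text{ and } \rho(R_{\lambda,b})\text{ is irrational}\}$ and $\rho(R_{\lambda,b})$ is the rotation number of the contracted rotation $R_{\lambda,b}$.
   Context: For real $\lambda,b$ with $0<1-\lambda<b<1$, the contracted rotation $R_{\lambda,b}:[0,1)\to[0,1)$ is the map $R_{\lambda,b}(x)=\lambda x+b\pmod 1$; explicitly, with $c=\frac{1-b}{\lambda}$, $R_{\lambda,b}(x)=\lambda x+b$ if $0\le x<c$ and $R_{\lambda,b}(x)=\lambda x+b-1$ if $c\le x<1$. Its rotation number $\rho(R_{\lambda,b})\in(0,1)$ is $\rho(R_{\lambda,b})=\lim_{n\to\infty}\frac{G^n(x)}{n}$, where $G:\mathbb{R}\to\mathbb{R}$, $G(x)=\lambda(x-\lfloor x\rfloor)+b+\lfloor x\rfloor$, is the lift of $R_{\lambda,b}$; the limit exists and does not depend on $x\in\mathbb{R}$. *)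

(* Defs.v *)
From mathcomp Require Import all_boot all_order all_algebra.
From mathcomp Require Import all_classical all_reals all_analysis.
From mathcomp Require Import ring lra.

Set Implicit Arguments.
Unset Strict Implicit.
Unset Printing Implicit Defensive.

Import Order.TTheory GRing.Theory Num.Theory.
Import numFieldNormedType.Exports.

Local Open Scope classical_set_scope.
Local Open Scope ring_scope.

Definition frac_part (R : realType) (x : R) : R := x - (Num.floor x)%:~R.

(* A total function on R; only its restriction to [0, 1) is meaningful. *)
Definition contracted_rotation (R : realType) (lambda b x : R) : R :=
  frac_part (lambda * x + b).

Definition contracted_rotation_lift (R : realType) (lambda b x : R) : R :=
  lambda * frac_part x + b + (Num.floor x)%:~R.

Lemma contracted_rotationE (R : realType) (lambda b x : R) :
  0 < 1 - lambda < b -> b < 1 -> 0 <= x < 1 ->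
  contracted_rotation lambda b x =
    if x < (1 - b) / lambda then lambda * x + b else lambda * x + b - 1.
Proof.
move=> /andP[l1 lb] b1 /andP[x0 x1].
have l0 : 0 < lambda by lra.
rewrite /contracted_rotation /frac_part ltr_pdivlMr// [x * _]mulrC.
have lx0 : 0 <= lambda * x by rewrite mulr_ge0// ltW.
have lx1 : lambda * x < lambda by rewrite gtr_pMr.
case: ifPn => [h|]; last rewrite -leNgt => h.
- by rewrite (@floor_def _ _ 0) ?subr0//; apply/andP; split; lra.
- by rewrite (@floor_def _ _ 1)//; apply/andP; split; lra.
Qed.

Lemma contracted_rotation_liftP (R : realType) (lambda b x : R) :
  frac_part (contracted_rotation_lift lambda b x) =
  contracted_rotation lambda b (frac_part x).
Proof.
rewrite /contracted_rotation_lift /contracted_rotation /frac_part.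
rewrite floorDrz ?intr_int// intrKfloor rmorphD /=; lra.
Qed.

(* The orbit of 0 is used; by rotation_number_cvg below the limit exists and is
   the same for every starting point. *)
Definition rotation_number (R : realType) (lambda b : R) : R :=
  lim ((fun n : nat => iter n (contracted_rotation_lift lambda b) 0 / n%:R)
       @ \oo).

Section RotationNumberCvg.
Context {R : realType}.
Variables lambda b : R.
Hypothesis lambda01 : 0 < lambda < 1.

Local Notation G := (contracted_rotation_lift lambda b).

Let frac_itv (x : R) : 0 <= frac_part x < 1.
Proof.
rewrite /frac_part subr_ge0 floor_le /= ltrBlDl.
by have := floorD1_gt x; rewrite intrD.
Qed.

Let lift_mono (x y : R) : x <= y -> G x <= G y.
Proof.
move=> xy; rewrite /contracted_rotation_lift.
have /andP[u0 u1] := frac_itv x; have /andP[v0 v1] := frac_itv y.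
have [l0 l1] := andP lambda01.
have xE : frac_part x = x - (Num.floor x)%:~R by [].
have yE : frac_part y = y - (Num.floor y)%:~R by [].
have := le_floor xy; rewrite le_eqVlt => /orP[/eqP e|].
  by rewrite xE yE e; nra.
by rewrite -lezD1 -(ler_int R) intrD; nra.
Qed.

Let liftD (x : R) (m : int) : G (x + m%:~R) = G x + m%:~R.
Proof.
rewrite /contracted_rotation_lift /frac_part floorDrz ?intr_int// intrKfloor.
by rewrite intrD; ring.
Qed.

Let iter_mono n (x y : R) : x <= y -> iter n G x <= iter n G y.
Proof. by elim: n => //= n IH xy; apply: lift_mono; apply: IH. Qed.

Let iter_liftD n (x : R) (m : int) : iter n G (x + m%:~R) = iter n G x + m%:~R.
Proof. by elim: n => //= n ->; rewrite liftD. Qed.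

Let iter_disp n (x y : R) : iter n G y - y <= iter n G x - x + 1.
Proof.
pose m := Num.floor (y - x).
have := floor_le (y - x); have := floorD1_gt (y - x); rewrite -/m => h1 h2.
have : iter n G y <= iter n G (x + (m + 1)%:~R) by apply: iter_mono; lra.
by rewrite iter_liftD; move: h1; rewrite intrD; lra.
Qed.

Let a n := iter n G 0.

Let aM m n : `|a (m * n) - m%:R * a n| <= m%:R.
Proof.
elim: m => [|m IH]; first by rewrite mul0n mul0r subrr normr0.
have := iter_disp n 0 (a (m * n)); have := iter_disp n (a (m * n)) 0.
rewrite mulSn.
have -> : iter n G (a (m * n)) = a (n + m * n) by rewrite /a iterD.
move: IH; rewrite -/(a n) -natr1 !ler_norml => /andP[? ?] ? ?.
by apply/andP; split; lra.
Qed.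

Let r := sup [set (a n.+1 - 1) / n.+1%:R | n in [set: nat]].

Let a_bound m n : (a m.+1 - 1) / m.+1%:R <= (a n.+1 + 1) / n.+1%:R.
Proof.
have m0 : (0 : R) < m.+1%:R by rewrite ltr0n.
have n0 : (0 : R) < n.+1%:R by rewrite ltr0n.
rewrite ler_pdivrMr// mulrAC ler_pdivlMr//.
have := aM m.+1 n.+1; have := aM n.+1 m.+1; rewrite mulnC !ler_norml.
move=> /andP[? ?] /andP[? ?]; lra.
Qed.

Let a_r n : `|a n.+1 - n.+1%:R * r| <= 1.
Proof.
have n0 : (0 : R) < n.+1%:R by rewrite ltr0n.
have h1 : (a n.+1 - 1) / n.+1%:R <= r.
  apply: ub_le_sup; last by exists n.
  by exists ((a 1 + 1) / 1%:R) => _ [m _ <-]; exact: a_bound.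
have h2 : r <= (a n.+1 + 1) / n.+1%:R.
  apply: ge_sup; first by exists ((a 1 - 1) / 1%:R); exists 0%N.
  by move=> _ [m _ <-]; exact: a_bound.
move: h1 h2; rewrite ler_pdivrMr// ler_pdivlMr// ler_norml => ? ?.
by apply/andP; split; lra.
Qed.

Let cvg_r (x : R) : (fun n : nat => iter n G x / n%:R) @ \oo --> r.
Proof.
pose C := `|x| + 2.
have C0 : 0 < C by rewrite ltr_wpDl.
apply/cvgrPdist_le => e e0; near=> n.
have n0 : (0 : R) < n%:R by rewrite ltr0n; near: n; exists 1%N.
have Cn : C <= e * n%:R.
  rewrite mulrC -ler_pdivrMr//; near: n; exact: nbhs_infty_ger.
have -> : r - iter n G x / n%:R = (n%:R * r - iter n G x) / n%:R.
  by rewrite mulrBl mulrAC divff ?mul1r// gt_eqF.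
rewrite normrM [X in _ * X]gtr0_norm ?invr_gt0// ler_pdivrMr//.
apply: le_trans Cn; rewrite /C.
have := iter_disp n 0 x; have := iter_disp n x 0; rewrite -/(a n).
have := a_r n.-1; rewrite prednK; last by move: n0; rewrite ltr0n.
have := ler_norm x; have := ler_norm (- x); rewrite normrN !ler_norml.
by move=> ? ? /andP[? ?] ? ?; apply/andP; split; lra.
Unshelve. all: by end_near. Qed.

Lemma rotation_number_cvg (x : R) :
  (fun n : nat => iter n G x / n%:R) @ \oo --> rotation_number lambda b.
Proof. by rewrite /rotation_number (cvg_lim _ (cvg_r 0)). Qed.

End RotationNumberCvg.

Definition irrational_params (R : realType) : set (R * R) :=
  [set p : R * R | [/\ 0 < 1 - p.1, 1 - p.1 < p.2, p.2 < 1 &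
            irrational (rotation_number p.1 p.2)]].

Section HausdorffDimension.
Context {R : realType}.
Local Open Scope ereal_scope.
Implicit Types (A : set R) (s delta : R).

(* 0 is adjoined so that the empty set has diameter 0 rather than -oo. *)
Definition diam A : \bar R :=
  ereal_sup ([set (0 : \bar R)] `|` [set (`|x - y| : R)%:E | x in A & y in A]).

(* diam A to the power s, where the empty set weighs 0 for s = 0 as well, since
   0 `^ 0 = 1. *)
Definition diam_pow s A : \bar R :=
  if A == set0 then 0 else diam A `^ s.

Definition hausdorff_premeasure s delta A : \bar R :=
  ereal_inf [set \sum_(k <oo) diam_pow s (U k) | U in
    [set U : nat -> set R |
      A `<=` \bigcup_k U k /\ forall k, diam (U k) <= delta%:E]].

(* The supremum over delta > 0 is the limit as delta tends to 0, because the
   premeasure is nonincreasing in delta. *)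
Definition hausdorff_measure s A : \bar R :=
  ereal_sup [set hausdorff_premeasure s delta A | delta in
    [set delta | (0 < delta)%R]].

Definition hausdorff_dim A : \bar R :=
  ereal_inf [set s%:E | s in
    [set s | (0 <= s)%R /\ hausdorff_measure s A = 0]].

End HausdorffDimension.

(* Main.v *)
(* For irrational [rho], the lift [G] satisfies [floor (G^k 0) = floor (k rho)].
   Let [f_k = floor (k rho)].  If [n] is such that the fractional part of
   [n rho] is smaller (resp. larger) than those of [k rho] for [1 <= k <= N],
   then [f_(n-k) = f_n - f_k - 1] (resp. [f_n - f_k]).  So if [l <= l'] have
   irrational rotation numbers with the same [f_k] for [k <= N], there are an
   orbit window of length [N] for [l] ending just above an integer and one for
   [l'] ending just below an integer that have the same itinerary.  As the map
   increases with the parameter and contracts, this forces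
   [l' - l <= l' ^ N / (1 - b)].  The vector [(f_k)] is monotone in [rho], hence
   takes at most quadratically many values in [N], and the parameters bounded by
   [mu < 1] are covered by [O(N^2)] sets of diameter [O(mu^N)]. *)
Require Import Defs.
From mathcomp Require Import all_boot all_order all_algebra.
From mathcomp Require Import all_classical all_reals all_analysis.
From mathcomp Require Import ring lra zify.

Set Implicit Arguments.
Unset Strict Implicit.
Unset Printing Implicit Defensive.

Import Order.TTheory GRing.Theory Num.Theory.
Import numFieldNormedType.Exports.

Local Open Scope classical_set_scope.
Local Open Scope ring_scope.

(** * Fractional parts of the multiples of an irrational number *)

Section Irrational.
Context {R : realType}.
Implicit Types (rho x : R).

Lemma frac_part_itv x : 0 <= frac_part x < 1.
Proof.
rewrite /frac_part subr_ge0 floor_le /= ltrBlDl.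
by have := floorD1_gt x; rewrite intrD.
Qed.

Lemma frac_partE x (m : int) :
  m%:~R <= x < m%:~R + 1 -> frac_part x = x - m%:~R.
Proof.
by move=> /andP[m1 m2]; rewrite /frac_part (@floor_def _ _ m)// m1 intrD.
Qed.

Lemma irrational_muln_neq_int rho (n : nat) (m : int) :
  irrational rho -> (0 < n)%N -> n%:R * rho != m%:~R.
Proof.
move=> irr n0; apply/eqP => e; apply: irr; apply/rationalP; exists m, n.
by rewrite -e mulrAC divff ?mul1r// pnatr_eq0 -lt0n.
Qed.

Lemma frac_part_irrational_gt0 rho (n : nat) :
  irrational rho -> (0 < n)%N -> 0 < frac_part (n%:R * rho).
Proof.
move=> irr n0; have /andP[f0 _] := frac_part_itv (n%:R * rho).
by rewrite lt_neqAle f0 andbT eq_sym subr_eq0 irrational_muln_neq_int.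
Qed.

(** Modulo 1 each multiple of [x] moves down by [d]. With [n] the integer part of [1 / d], the
    product [n * d] lies in [(1 - d, 1]], so the fractional part of [n * x] is [1 - n * d < d]. *)
Lemma frac_part_mul_lt x (d : R) (m : int) :
  0 < d < 1 -> x = m%:~R - d ->
  exists2 n : nat, (0 < n)%N & frac_part (n%:R * x) < d.
Proof.
move=> /andP[d0 d1] xE.
have dV : 1 < d^-1 by rewrite invf_gt1.
have := truncn_itv (ltW (lt_trans ltr01 dV)).
set n := Num.truncn _ => /andP[n1 n2].
have n0 : (0 < n)%N by rewrite truncn_gt0 ltW.
move: n1; rewrite -(ler_pM2r d0) mulVf ?gt_eqF// => n1.
move: n2; rewrite -(ltr_pM2r d0) mulVf ?gt_eqF// -natr1 mulrDl mul1r => n2.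
have nd0 : 0 < n%:R * d by rewrite mulr_gt0// ltr0n.
exists n => //; rewrite xE mulrBr (@frac_partE _ (n%:Z * m - 1)).
  rewrite intrB intrM; lra.
rewrite intrB intrM; apply/andP; split; lra.
Qed.

(* Let [a] be the infimum and [t = frac_part (n * rho)] with [a <= t < 2 * a]:
   a multiple of [n * rho] falls short of an integer by [d <= t - a < a], and by
   frac_part_mul_lt some multiple of that one has fractional part below [d]. *)
Lemma frac_part_muln_lt rho (e : R) : irrational rho -> 0 < e ->
  exists2 n : nat, (0 < n)%N & frac_part (n%:R * rho) < e.
Proof.
move=> irr e0; pose A := [set frac_part (n.+1%:R * rho) | n in [set: nat]].
have A0 : A (frac_part (1 * rho)) by exists 0%N.
have Alb : lbound A 0.
  by move=> _ [n _ <-]; case/andP: (frac_part_itv (n.+1%:R * rho)).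
have Ainf : has_inf A by split; [exists (frac_part (1 * rho))|exists 0].
have infA n : (0 < n)%N -> inf A <= frac_part (n%:R * rho).
  by move=> n0; apply: ge_inf; [exists 0|exists n.-1; rewrite ?prednK].
have [a0|a0] := leP (inf A) 0.
  have [_ [n _ <-] h] := inf_adherent e0 Ainf.
  by exists n.+1 => //; lra.
have [_ [n _ <-]] := inf_adherent a0 Ainf.
set t := frac_part _ => ta; exfalso.
have at1 : inf A <= t by exact: infA.
have /andP[t0 t1] : 0 <= t < 1 by exact: frac_part_itv.
have tgt0 : 0 < t by lra.
have tE : n.+1%:R * rho = t + (Num.floor (n.+1%:R * rho))%:~R.
  by rewrite /t /frac_part subrK.
move: tE; set m := Num.floor _ => tE.
have tV : 1 < t^-1 by rewrite invf_gt1.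
have := truncn_itv (ltW (lt_trans ltr01 tV)).
set k := Num.truncn _ => /andP[].
rewrite -(ler_pM2r tgt0) mulVf ?gt_eqF// => k1.
rewrite -(ltr_pM2r tgt0) mulVf ?gt_eqF// => k2.
have k0 : (0 < k)%N by rewrite truncn_gt0 ltW.
have kE : (k * n.+1)%:R * rho = k%:R * t + (k%:Z * m)%:~R.
  by rewrite natrM -mulrA tE intrM; ring.
have kSE : (k.+1 * n.+1)%:R * rho = k.+1%:R * t + (k.+1%:Z * m)%:~R.
  by rewrite natrM -mulrA tE intrM; ring.
have d0 : 0 < 1 - k%:R * t.
  rewrite subr_gt0 lt_neqAle k1 andbT; apply/negP => /eqP kt.
  have := @irrational_muln_neq_int rho (k * n.+1) (1 + k%:Z * m) irr.
  by rewrite muln_gt0 k0 kE kt intrD eqxx => /(_ isT).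
(* Here [d = 1 - k * t], and [(k + 1) * t] passes 1 by [t - d]. Being itself a fractional part of a
   multiple of [rho], [t - d] is at least [inf A]. *)
have dt : t - (1 - k%:R * t) = frac_part ((k.+1 * n.+1)%:R * rho).
  rewrite (@frac_partE _ (k.+1%:Z * m + 1)) kSE intrD -natr1; first by lra.
  by move: k2; rewrite -natr1 => k2; apply/andP; split; lra.
have := infA (k.+1 * n.+1)%N isT; rewrite -dt => da.
have [||i i0] := @frac_part_mul_lt ((k * n.+1)%:R * rho) (1 - k%:R * t)
    (1 + k%:Z * m).
- by apply/andP; split; lra.
- by rewrite kE intrD; ring.
rewrite mulrA -natrM => hi.
have := infA (i * (k * n.+1))%N; rewrite !muln_gt0 i0 k0 => /(_ isT); lra.
Qed.

(** A multiple whose fractional part is below the minimum over [1 <= k <= N] cannot itself have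
    index at most [N]. *)
Lemma exists_min_frac_part rho (N : nat) : irrational rho ->
  exists2 n : nat, (N < n)%N & forall k, (0 < k <= N)%N ->
    frac_part (n%:R * rho) < frac_part (k%:R * rho).
Proof.
move=> irr; pose e := \big[Num.min/1]_(1 <= k < N.+1) frac_part (k%:R * rho).
have ele k : (0 < k <= N)%N -> e <= frac_part (k%:R * rho).
  by move=> kN; apply: ge_bigmin_seq => //; rewrite mem_index_iota ltnS.
have e0 : 0 < e.
  rewrite /e big_seq; elim/big_ind : _ => //.
  - by move=> x y x0 y0; rewrite lt_min x0.
  - move=> k; rewrite mem_index_iota => /andP[k0 _].
    exact: frac_part_irrational_gt0.
have [n n0 ne] := frac_part_muln_lt irr e0.
exists n; last by move=> k /ele; exact: lt_le_trans.
rewrite ltnNge; apply/negP => nN.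
by have := ele n; rewrite n0 nN => /(_ isT); rewrite leNgt ne.
Qed.

(** The fractional part of [n * rho] minus that of [k * rho] lies in [(-1, 0)], so the subtraction
    borrows 1. *)
Lemma floor_muln_backward_min rho (N : nat) : irrational rho ->
  exists2 n : nat, (N < n)%N & forall k, (0 < k <= N)%N ->
    Num.floor ((n - k)%:R * rho) =
    Num.floor (n%:R * rho) - Num.floor (k%:R * rho) - 1.
Proof.
move=> irr; have [n Nn nlt] := exists_min_frac_part N irr.
exists n => // k kN; have := nlt k kN.
have /andP[] := frac_part_itv (n%:R * rho).
have /andP[] := frac_part_itv (k%:R * rho).
rewrite /frac_part => k0 k1 n0 n1 nk; apply: floor_def.
have kn : (k <= n)%N by lia.
by rewrite natrB// mulrBl !(intrB, intrD); apply/andP; split; lra.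
Qed.

Lemma floorN_irrational rho (n : nat) : irrational rho -> (0 < n)%N ->
  Num.floor (n%:R * - rho) = - Num.floor (n%:R * rho) - 1.
Proof.
move=> irr n0; have := frac_part_irrational_gt0 irr n0.
have /andP[_] := frac_part_itv (n%:R * rho); rewrite /frac_part => h1 h2.
by apply: floor_def; rewrite mulrN !(intrB, intrD, intrN);
  apply/andP; split; lra.
Qed.

Lemma irrationalN rho : irrational rho -> irrational (- rho).
Proof.
move=> irr /rationalP[m [n e]]; apply: irr; apply/rationalP.
by exists (- m), n; rewrite intrN mulNr -e opprK.
Qed.

(** Negation turns smallest fractional parts into largest ones, so the previous case is applied to
    [- rho]. *)
Lemma floor_muln_backward_max rho (N : nat) : irrational rho ->
  exists2 n : nat, (N < n)%N & forall k, (0 < k <= N)%N ->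
    Num.floor ((n - k)%:R * rho) =
    Num.floor (n%:R * rho) - Num.floor (k%:R * rho).
Proof.
move=> irr; have [n Nn h] := floor_muln_backward_min N (irrationalN irr).
exists n => // k kN; have := h k kN.
by rewrite !floorN_irrational//; lia.
Qed.

End Irrational.

(** * Two affine orbits with a common itinerary *)

(** The gap [y' - y] starts above -1. Each step multiplies it by [l'] and adds
    [(l' - l) * (y j - e j) >= 0], so it stays above [- l' ^+ j]; at the last step the added term is
    kept. *)
Lemma affine_orbits_parameter_gap (R : realType) (l l' b : R) (y y' : nat -> R)
    (e : nat -> R) (N : nat) :
  0 < l' -> l <= l' ->
  (forall j, (j <= N)%N -> e j <= y j < e j + 1) ->
  (forall j, (j <= N)%N -> e j <= y' j < e j + 1) ->
  (forall j, (j <= N)%N -> y j.+1 = l * (y j - e j) + b + e j) ->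
  (forall j, (j <= N)%N -> y' j.+1 = l' * (y' j - e j) + b + e j) ->
  (l' - l) * (y N - e N) <= l' ^+ N.+1 + (y' N.+1 - y N.+1).
Proof.
move=> l'0 ll' ye y'e yS y'S.
have H j : (j <= N)%N -> - l' ^+ j <= y' j - y j.
  elim: j => [|j IH] jN.
    move: (ye 0%N jN) (y'e 0%N jN) => /andP[? ?] /andP[? ?].
    by rewrite expr0; lra.
  have jN' := ltnW jN; have := IH jN'; rewrite yS// y'S// exprS.
  rewrite -subr_ge0 -(ler_pM2l l'0) mulr0 => h.
  have /andP[y0 _] := ye j jN'.
  have : 0 <= (l' - l) * (y j - e j) by rewrite mulr_ge0// subr_ge0.
  by move: h; lra.
have := H N (leqnn N); rewrite yS// y'S// exprS.
by rewrite -subr_ge0 -(ler_pM2l l'0) mulr0; lra.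
Qed.

(** * Integer parts of the orbit of 0 and the rotation number *)

Section Lift.
Context {R : realType}.
Variables lambda b : R.
Hypothesis lambda01 : 0 < lambda < 1.

Local Notation G := (contracted_rotation_lift lambda b).
Local Notation rho := (rotation_number lambda b).

(** Between integers the lift has slope [lambda]; at each integer it jumps up by [1 - lambda]. *)
Lemma lift_mono (x y : R) : x <= y -> G x <= G y.
Proof.
move=> xy; rewrite /contracted_rotation_lift.
have /andP[u0 u1] := frac_part_itv x; have /andP[v0 v1] := frac_part_itv y.
have [l0 l1] := andP lambda01.
have xE : frac_part x = x - (Num.floor x)%:~R by [].
have yE : frac_part y = y - (Num.floor y)%:~R by [].
have := le_floor xy; rewrite le_eqVlt => /orP[/eqP e|].
  by rewrite xE yE e; nra.
by rewrite -lezD1 -(ler_int R) intrD; nra.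
Qed.

Lemma iter_lift_mono n (x y : R) : x <= y -> iter n G x <= iter n G y.
Proof. by elim: n => //= n IH xy; apply: lift_mono; apply: IH. Qed.

Lemma iter_lift_intrD n (m : int) : iter n G m%:~R = iter n G 0 + m%:~R.
Proof.
elim: n => [|n IH] /=; first by rewrite add0r.
rewrite IH /contracted_rotation_lift /frac_part floorDrz ?intr_int// intrKfloor.
by rewrite intrD; ring.
Qed.

Lemma rotation_number_muln_cvg (q : nat) : (0 < q)%N ->
  (fun m : nat => iter (m * q) G 0 / m%:R) @ \oo --> q%:R * rho.
Proof.
move=> q0.
have mq : (fun m : nat => m * q)%N @ \oo --> \oo.
  apply/cvgnyPge => A; exists A => // m /= Am.
  by rewrite (leq_trans Am)// leq_pmulr.
have : (fun m : nat => q%:R * (iter (m * q) G 0 / (m * q)%:R)) @ \oo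
    --> q%:R * rho.
  apply: cvgMl_tmp; exact: cvg_comp mq (rotation_number_cvg lambda01 0).
apply: cvg_trans; apply: near_eq_cvg; near=> m => /=.
by rewrite natrM invfM mulrCA [X in _ * X]mulrCA divff ?mulr1// pnatr_eq0 -lt0n.
Unshelve. all: by end_near. Qed.

(** Monotonicity and commutation with integer translations iterate the hypothesis to
    [m * p <= G^(m * q) 0]; divide by [m] and pass to the limit. *)
Lemma rotation_number_ge (q : nat) (p : int) : (0 < q)%N ->
  p%:~R <= iter q G 0 -> p%:~R <= q%:R * rho.
Proof.
move=> q0 pq; have cvgq := rotation_number_muln_cvg q0.
rewrite -(cvg_lim _ cvgq)//; apply: limr_ge; first by apply: cvgP cvgq.
near=> m; have m0 : (0 < m)%N by near: m; exists 1%N.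
rewrite ler_pdivlMr ?ltr0n//; elim: (m) => [|k IH]; first by rewrite mulr0.
rewrite mulSn iterD; apply: (le_trans _ (@iter_lift_mono q (p * k)%:~R _ _)).
  by rewrite iter_lift_intrD intrM -natr1; lra.
by rewrite intrM.
Unshelve. all: by end_near. Qed.

Lemma rotation_number_le (q : nat) (p : int) : (0 < q)%N ->
  iter q G 0 <= p%:~R -> q%:R * rho <= p%:~R.
Proof.
move=> q0 pq; have cvgq := rotation_number_muln_cvg q0.
rewrite -(cvg_lim _ cvgq)//; apply: limr_le; first by apply: cvgP cvgq.
near=> m; have m0 : (0 < m)%N by near: m; exists 1%N.
rewrite ler_pdivrMr ?ltr0n//; elim: (m) => [|k IH]; first by rewrite mulr0.
rewrite mulSn iterD; apply: (le_trans (@iter_lift_mono q _ (p * k)%:~R _)).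
  by rewrite intrM.
by rewrite iter_lift_intrD intrM -natr1; lra.
Unshelve. all: by end_near. Qed.

(** Integer bounds on [G^q 0] pass to [q * rho]; the upper one stays strict because [q * rho] is not
    an integer. *)
Lemma floor_iter_lift (q : nat) : irrational rho ->
  Num.floor (iter q G 0) = Num.floor (q%:R * rho).
Proof.
move=> irr; case: q => [|q]; first by rewrite mul0r.
apply/esym/floor_def; have /andP[h1 h2] := floor_itv (iter q.+1 G 0).
rewrite (rotation_number_ge _ h1)//= lt_neqAle.
by rewrite irrational_muln_neq_int// rotation_number_le// ltW.
Qed.

End Lift.

(** * Distance between parameters with the same floors *)

Section ParameterGap.
Context {R : realType}.
Implicit Types (l b : R).

Lemma lift_floorE l b (x : R) (m : int) : Num.floor x = m ->
  contracted_rotation_lift l b x = l * (x - m%:~R) + b + m%:~R.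
Proof. by move=> <-. Qed.

Lemma floor_rotation_number l b : 0 < l < 1 -> 0 < b < 1 ->
  irrational (rotation_number l b) -> Num.floor (rotation_number l b) = 0.
Proof.
move=> l01 /andP[b0 b1] irr; rewrite -[rotation_number l b]mul1r.
rewrite -(floor_iter_lift l01 1)//= (@lift_floorE _ _ _ 0) ?floor0//.
by apply: floor_def; apply/andP; split; lra.
Qed.

Lemma parameter_gap l l' b (N : nat) : 0 < l -> l <= l' -> l' < 1 ->
  0 < b < 1 ->
  irrational (rotation_number l b) -> irrational (rotation_number l' b) ->
  (forall k, (0 < k <= N.+1)%N -> Num.floor (k%:R * rotation_number l b) =
                                  Num.floor (k%:R * rotation_number l' b)) ->
  l' - l <= l' ^+ N.+1 / (1 - b).
Proof.
move=> l0 ll' l'1 b01 irr irr' eqf.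
have l01 : 0 < l < 1 by rewrite l0 (le_lt_trans ll').
have l'01 : 0 < l' < 1 by rewrite (lt_le_trans l0).
have [n Nn nP] := floor_muln_backward_min N.+1 irr.
have [n' Nn' nP'] := floor_muln_backward_max N.+1 irr'.
set rho := rotation_number l b in irr eqf nP.
set rho' := rotation_number l' b in irr' eqf nP'.
(* The extra 1 in [m'] makes up for the borrow that occurs only for [n]; after these shifts both
   windows have floors [e j]. *)
pose m := Num.floor (n%:R * rho); pose m' := Num.floor (n'%:R * rho') + 1.
pose y j := iter (n - N.+1 + j) (contracted_rotation_lift l b) 0 - m%:~R.
pose y' j := iter (n' - N.+1 + j) (contracted_rotation_lift l' b) 0 - m'%:~R.
pose e j : int := - Num.floor ((N.+1 - j)%:R * rho) - 1.
have flx j : (j <= N)%N ->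
    Num.floor (iter (n - N.+1 + j) (contracted_rotation_lift l b) 0) = e j + m.
  move=> jN; rewrite floor_iter_lift//
    (_ : (_ + _)%N = n - (N.+1 - j))%N; last by lia.
  by rewrite nP; [rewrite /e /m; lia|lia].
have flx' j : (j <= N)%N ->
    Num.floor (iter (n' - N.+1 + j) (contracted_rotation_lift l' b) 0) =
    e j + m'.
  move=> jN; rewrite floor_iter_lift//
    (_ : (_ + _)%N = n' - (N.+1 - j))%N; last by lia.
  rewrite nP'; last by lia.
  by rewrite /e /m' eqf; lia.
have itv x (p q : int) : Num.floor x = p + q ->
    p%:~R <= (x : R) - q%:~R < p%:~R + 1.
  have := floor_itv x => /[swap] ->; rewrite !intrD => /andP[? ?].
  by apply/andP; split; lra.
have yS j : (j <= N)%N -> y j.+1 = l * (y j - (e j)%:~R) + b + (e j)%:~R.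
  by move=> jN; rewrite /y addnS iterS (lift_floorE _ _ (flx j jN)) intrD; ring.
have y'S j : (j <= N)%N -> y' j.+1 = l' * (y' j - (e j)%:~R) + b + (e j)%:~R.
  move=> jN; rewrite /y' addnS iterS (lift_floorE _ _ (flx' j jN)) intrD.
  by ring.
have := @affine_orbits_parameter_gap R l l' b y y' (fun j => (e j)%:~R) N.
have -> : 0 < l' by lra.
move=> /(_ isT ll' (fun j jN => itv _ _ _ (flx j jN))
  (fun j jN => itv _ _ _ (flx' j jN)) yS y'S).
(* At the times [n] and [n'] the itineraries part: [y] ends in [[0, 1)] and [y'] in [[-1, 0)], so
   the final gap is negative. *)
have yN : 0 <= y N.+1 < 0 + 1.
  apply: (itv _ 0); rewrite subnK 1?ltnW// floor_iter_lift//.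
  by rewrite add0r.
have y'N : -1 <= y' N.+1 < -1 + 1.
  apply: (itv _ (-1)); rewrite subnK 1?ltnW// floor_iter_lift//.
  by rewrite /m' addrCA addrN addr0.
have eN : e N = -1.
  by rewrite /e subSnn mul1r floor_rotation_number.
have := yS N (leqnn N); rewrite eN.
move: y'N yN b01 => /andP[_ y'1] /andP[y0 _] /andP[b0 b1] yNE h.
(* Since [0 <= y N.+1 = l * (y N + 1) + b - 1], the product [l * (y N + 1)] is at least [1 - b], and
   [l < 1]. *)
have yb : 1 - b <= y N - (-1)%:~R.
  have yb0 : 0 < l * (y N - (-1)%:~R) by lra.
  have : 0 <= (1 - l) * (y N - (-1)%:~R).
    by rewrite mulr_ge0; [by []|lra|]; move: yb0; rewrite pmulr_rgt0//; lra.
  by lra.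
rewrite ler_pdivlMr; last lra.
have : 0 <= (l' - l) * (y N - (-1)%:~R - (1 - b)).
  by rewrite mulr_ge0; [by []|lra|lra].
by lra.
Qed.

End ParameterGap.

(** * Covers and vanishing Hausdorff measure *)

Section HausdorffNull.
Context {R : realType}.
Implicit Types (A : set R) (s : R).

Lemma diam_ge0 A : (0 <= diam A)%E.
Proof. by apply: ereal_sup_ubound; left. Qed.

Lemma diam_le A (C : R) : 0 <= C ->
  (forall x y, A x -> A y -> `|x - y| <= C) -> (diam A <= C%:E)%E.
Proof.
move=> C0 AC; apply: ge_ereal_sup => _ [->|[x Ax [y Ay <-]]].
  by rewrite lee_fin.
by rewrite lee_fin AC.
Qed.

Lemma diam_pow_ge0 s A : (0 <= diam_pow s A)%E.
Proof. by rewrite /diam_pow; case: ifP => // _; exact: poweR_ge0. Qed.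

Lemma diam_pow_set0 s : diam_pow s (set0 : set R) = 0%E.
Proof. by rewrite /diam_pow eqxx. Qed.

Lemma diam_pow_le s A (C : R) : 0 <= s -> 0 <= C -> (diam A <= C%:E)%E ->
  (diam_pow s A <= (C `^ s)%:E)%E.
Proof.
move=> s0 C0 AC; rewrite /diam_pow; case: ifP => _.
  by rewrite lee_fin powR_ge0.
by rewrite -poweR_EFin; apply: gt0_ler_poweR => //;
  rewrite in_itv/= ?leey ?andbT ?diam_ge0.
Qed.

(** Null measure phrased with explicit covers, the form that passes to countable unions. *)
Definition hausdorff_null s A := forall delta eps : R, 0 < delta -> 0 < eps ->
  exists U : nat -> set R, [/\ A `<=` \bigcup_k U k,
    forall k, (diam (U k) <= delta%:E)%E &
    (\sum_(k <oo) diam_pow s (U k) <= eps%:E)%E].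

Lemma hausdorff_null_measure s A :
  hausdorff_null s A -> hausdorff_measure s A = 0%E.
Proof.
move=> nA; have pre0 (delta : R) : 0 < delta ->
    hausdorff_premeasure s delta A = 0%E.
  move=> d0; apply/eqP; rewrite eq_le; apply/andP; split.
    apply/lee_addgt0Pr => e e0; rewrite add0e.
    have [U [AU Ud Ue]] := nA _ _ d0 e0.
    by apply: le_trans Ue; apply: ereal_inf_lbound; exists U.
  apply: le_ereal_inf_tmp => _ [U _ <-].
  by apply: nneseries_ge0 => k _ _; exact: diam_pow_ge0.
apply/eqP; rewrite eq_le; apply/andP; split.
  by apply: ge_ereal_sup => _ [d d0 <-]; rewrite pre0.
by apply: ereal_sup_ubound; exists 1; [exact: ltr01|rewrite pre0].
Qed.

(** The set [A m] gets a cover of weight at most [eps / 2 ^ m.+1]; a bijection of [nat] with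
    [nat * nat] lists all the covers as one sequence. *)
Lemma hausdorff_null_bigcup s (A : nat -> set R) :
  (forall m, hausdorff_null s (A m)) -> hausdorff_null s (\bigcup_m A m).
Proof.
move=> nA delta eps d0 e0.
have /choice[U UP] : forall m, exists U : nat -> set R,
    [/\ A m `<=` \bigcup_k U k,
    forall k, (diam (U k) <= delta%:E)%E &
    (\sum_(k <oo) diam_pow s (U k) <= (eps / (2 ^ m.+1)%:R)%:E)%E].
  by move=> m; apply: nA => //; rewrite divr_gt0// ltr0n expn_gt0.
have /card_esym/ppcard_eqP[f] := card_nat2.
exists (fun k => U (f k).1 (f k).2); split => [x [m _ Amx]|k|].
- have [AU _ _] := UP m; have [j _ Ujx] := AU x Amx.
  by exists (f^-1%FUN (m, j)) => //=; rewrite invK ?inE.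
- by have [_ + _] := UP (f k).1; apply.
rewrite nneseries_esumT; last by move=> k; exact: diam_pow_ge0.
rewrite -(@reindex_esum _ _ _ setT setT f (fun p => diam_pow s (U p.1 p.2)));
  last exact: 'bij_f.
rewrite (_ : setT = [set: nat] `*`` (fun=> [set: nat])); last first.
  by apply/seteqP; split.
rewrite -(@esum_esum _ _ _ _ _ (fun i j => diam_pow s (U i j))); last first.
  by move=> *; exact: diam_pow_ge0.
rewrite -nneseries_esumT; last first.
  by move=> k; apply: esum_ge0 => *; exact: diam_pow_ge0.
apply: le_trans (epsilon_trick0 xpredT (ltW e0)).
apply: lee_nneseries => [m _ _|m _].
  by apply: esum_ge0 => *; exact: diam_pow_ge0.
rewrite -nneseries_esumT; last by move=> *; exact: diam_pow_ge0.
by have [] := UP m.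
Qed.

(** Each of the [n.+1] terms of [1 + t + ... + t ^+ n] is at least [t ^+ n], and [1 - t] times this
    sum telescopes. *)
Lemma muln_expr_le (t : R) (n : nat) : 0 <= t <= 1 ->
  n.+1%:R * t ^+ n * (1 - t) <= 1 - t ^+ n.+1.
Proof.
move=> /andP[t0 t1]; elim: n => [|n IH]; first by rewrite expr0 !mul1r expr1.
have tn0 : 0 <= t ^+ n.+1 by rewrite exprn_ge0.
have tn1 : t ^+ n.+1 <= 1 by rewrite exprn_ile1.
have h1 : 0 <= (1 - t) * (1 - t ^+ n.+1) by rewrite mulr_ge0; [by []|lra|lra].
have h2 := ler_wpM2l t0 IH.
rewrite -natr1 exprS [t ^+ n.+2]exprS.
move: h1 h2; rewrite exprS; lra.
Qed.

Lemma hausdorff_null_quadratic_cover s A (mu C : R) :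
  0 < s -> 0 <= mu < 1 -> 0 <= C ->
  (forall N : nat, exists V : nat -> set R,
    A `<=` \bigcup_(k in `I_(N.+1 ^ 2)) V k /\
    forall k x y, V k x -> V k y -> `|x - y| <= C * mu ^+ N) ->
  hausdorff_null s A.
Proof.
move=> s0 /andP[mu0 mu1] C0 H delta eps d0 e0.
(* Of the three factors [t ^+ N] of [(mu ^+ N) `^ s], two absorb [N.+1 ^ 2]. *)
pose t := mu `^ (s / 3%:R).
have t0 : 0 <= t by exact: powR_ge0.
have t1 : t < 1.
  have s3 : 0 < s / 3%:R by rewrite divr_gt0.
  by have := gt0_ltr_powR s3 mu0 (ler01 : 1 \is Num.nneg) mu1; rewrite powR1.
have powE N : (C * mu ^+ N) `^ s = C `^ s * (t ^+ N) ^+ 3.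
  rewrite powRM ?exprn_ge0//; congr (_ * _).
  rewrite -exprM -(powR_mulrn N mu0) -(powR_mulrn (N * 3) t0) /t -!powRrM.
  by congr (_ `^ _); rewrite natrM; field.
pose K := (1 - t)^-1 ^+ 2 * C `^ s.
have bnd N : (N.+1 ^ 2)%:R * (C * mu ^+ N) `^ s <= K * t ^+ N.
  have tN0 : 0 <= t ^+ N by exact: exprn_ge0.
  have : N.+1%:R * t ^+ N <= (1 - t)^-1.
    rewrite -[leRHS]div1r ler_pdivlMr ?subr_gt0//.
    have := @muln_expr_le t N; rewrite t0 ltW// => /(_ isT) /le_trans; apply.
    by rewrite gerBl exprn_ge0.
  move=> /(lerXn2r 2); rewrite !nnegrE mulr_ge0// invr_ge0 subr_ge0 (ltW t1).
  move=> /(_ isT isT); rewrite powE natrX.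
  have CtN0 : 0 <= C `^ s * t ^+ N by rewrite mulr_ge0// powR_ge0.
  by move=> h; have := ler_wpM2r CtN0 h; rewrite /K; lra.
have K0 : 0 <= K by rewrite mulr_ge0 ?powR_ge0// exprn_ge0// invr_ge0; lra.
have [N [Nd Ne]] : exists N, C * mu ^+ N <= delta /\ K * t ^+ N <= eps.
  have cvg0 (c r : R) : 0 <= r < 1 -> (fun n => c * r ^+ n) @ \oo --> (0 : R).
    move=> /andP[r0 r1]; rewrite -[X in _ --> X](mulr0 c); apply: cvgMl_tmp.
    by apply: cvg_expr; rewrite ger0_norm.
  near \oo => N; exists N; split; apply: ltW; near: N.
  - by apply: (cvgr_lt 0) => //; apply: cvg0; rewrite mu0.
  - by apply: (cvgr_lt 0) => //; apply: cvg0; rewrite t0.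
have [V [AV VN]] := H N.
have CN0 : 0 <= C * mu ^+ N by rewrite mulr_ge0// exprn_ge0.
have Vd k : (diam (V k) <= (C * mu ^+ N)%:E)%E.
  by apply: diam_le => //; exact: VN.
(* The finite cover is padded with empty sets, whose [diam_pow] is 0. *)
exists (fun k => if (k < N.+1 ^ 2)%N then V k else set0).
split => [x /AV[k /= kN Vkx]|k|].
- by exists k => //; rewrite kN.
- case: ifP => _; first by rewrite (le_trans (Vd k))// lee_fin.
  by apply: diam_le => //; exact: ltW.
rewrite (nneseries_split 0 (N.+1 ^ 2)); last by move=> *; exact: diam_pow_ge0.
rewrite add0n [X in (_ + X)%E]eseries0 ?adde0; last first.
  by move=> k kN _; rewrite ltnNge kN /= diam_pow_set0.
apply: (@le_trans _ _ (\sum_(0 <= k < N.+1 ^ 2) ((C * mu ^+ N) `^ s)%:E)%E).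
  apply: lee_sum => k _; case: ifP => _.
    by apply: diam_pow_le => //; exact: ltW.
  by rewrite diam_pow_set0 lee_fin powR_ge0.
rewrite sumEFin lee_fin big_const_nat subn0 iter_addr_0 -mulr_natl.
by apply: le_trans Ne.
Unshelve. all: by end_near. Qed.

Lemma hausdorff_dim_eq0 A : (forall s, 0 < s -> hausdorff_null s A) ->
  hausdorff_dim A = 0%E.
Proof.
move=> nA; apply/eqP; rewrite eq_le; apply/andP; split.
  apply/lee_addgt0Pr => e e0; rewrite add0e; apply: ereal_inf_lbound.
  by exists e => //; split; [exact: ltW|exact/hausdorff_null_measure/nA].
by apply: le_ereal_inf_tmp => _ [s [s0 _] <-]; rewrite lee_fin.
Qed.

End HausdorffNull.

(** * Counting the vectors of floors *)

Section FloorSum.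
Context {R : realType}.
Implicit Types rho : R.

(** A single natural number encoding the vector of floors, to index the pieces of a cover. For
    [rho >= 0] the absolute values only convert to [nat]. *)
Definition floor_sum (N : nat) rho : nat :=
  (\sum_(i < N.+1) `|Num.floor (i.+1%:R * rho)|)%N.

(** As [0 <= rho < 1], each of the [N.+1] floors is at most [N]. *)
Lemma floor_sum_lt N rho : Num.floor rho = 0 -> (floor_sum N rho < N.+1 ^ 2)%N.
Proof.
move=> f0; have /andP[] := floor_itv rho; rewrite f0 add0r => r0 r1.
apply: (@leq_ltn_trans (\sum_(i < N.+1) N)).
  apply: leq_sum => i _; have iN := ltn_ord i.
  have : 0 <= Num.floor (i.+1%:R * rho) by rewrite floor_ge_int mulr_ge0.
  have : Num.floor (i.+1%:R * rho) < i.+1.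
    by rewrite floor_lt_int gtr_pMr// ltr0n.
  lia.
by rewrite sum_nat_const card_ord; lia.
Qed.

(* The floors are all monotone in [rho], so that their sum determines each. *)
Lemma floor_sum_inj N rho rho' : 0 <= rho -> 0 <= rho' ->
  floor_sum N rho = floor_sum N rho' ->
  forall k, (0 < k <= N.+1)%N ->
    Num.floor (k%:R * rho) = Num.floor (k%:R * rho').
Proof.
wlog le_rho : rho rho' / rho <= rho'.
  move=> wl r0 r'0 e k kN; have [le|/ltW le] := leP rho rho'; first exact: wl.
  by apply/esym/wl.
move=> r0 r'0 e k /andP[k0 kN].
have fge0 i (x : R) : 0 <= x -> 0 <= Num.floor (i%:R * x).
  by move=> x0; rewrite floor_ge_int mulr_ge0.
have le i : (`|Num.floor (i%:R * rho)| <= `|Num.floor (i%:R * rho')|)%N.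
  have := fge0 i _ r0; have := fge0 i _ r'0.
  have : Num.floor (i%:R * rho) <= Num.floor (i%:R * rho').
    by apply: le_floor; rewrite ler_wpM2l.
  lia.
have := leqif_sum (fun (i : 'I_N.+1) (_ : xpredT i) => leqif_eq (le i.+1)).
move=> [_]; rewrite -/(floor_sum N rho) -/(floor_sum N rho') e eqxx => /esym.
move=> /forallP /(_ (Ordinal (_ : k.-1 < N.+1)%N)) h.
have kN' : (k.-1 < N.+1)%N by lia.
have := h kN'; rewrite /= prednK// => /eqP.
by have := fge0 k _ r0; have := fge0 k _ r'0; lia.
Qed.

End FloorSum.

(** * The set of parameters with irrational rotation number *)

Theorem corollary8 (R : realType) (b : R) (hb : 0 < b < 1) :
  hausdorff_dim [set lambda : R | 0 < lambda < 1 /\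
                                  @irrational_params R (lambda, b)] = 0%E.
Proof.
have b1 : 0 < 1 - b by case/andP: hb; lra.
apply: hausdorff_dim_eq0 => s s0.
(* Exhausting the parameters by [l <= mu m] makes the contraction rate uniform on each piece. *)
pose mu m : R := 1 - m.+1%:R^-1.
set E := [set lambda | _].
have -> : E = \bigcup_m (E `&` [set l | l <= mu m]).
  apply/seteqP; split => [l El|l [m _ []]//].
  have [/andP[_ l1] _] := El; rewrite -subr_gt0 in l1.
  have [m _ mP] := near_infty_natSinv_lt (PosNum l1).
  have : m.+1%:R^-1 < 1 - l := mP m (leqnn m).
  by exists m => //; split=> //=; rewrite lerBrDr -lerBrDl ltW.
apply: hausdorff_null_bigcup => m.
have m1 : 0 < (m.+1%:R : R)^-1 <= 1.
  by rewrite invr_gt0 ltr0n invf_le1 ?ltr0n// ler1n.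
have mu01 : 0 <= mu m < 1 by case/andP: m1 => m0 m1; rewrite subr_ge0 m1 gtrBl.
apply: (@hausdorff_null_quadratic_cover _ _ _ (mu m) (1 - b)^-1) => //.
  by rewrite invr_ge0 ltW.
move=> N; pose rho l := rotation_number l b.
exists (fun k => E `&` [set l | l <= mu m]
                  `&` [set l | floor_sum N (rho l) = k]).
have fl0 l : E l -> Num.floor (rho l) = 0.
  by move=> [l01 [_ _ _ irr]]; exact: floor_rotation_number.
have rho0 l : E l -> 0 <= rho l.
  by move=> /fl0 f0; rewrite -[0]/(0%:~R) -floor_ge_int f0.
split => [l [El lmu]|k x y].
  by exists (floor_sum N (rho l)) => //=; exact/floor_sum_lt/fl0.
wlog xy : x y / x <= y.
  move=> wl Vx Vy; have [xy|/ltW yx] := leP x y; first exact: wl.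
  by rewrite distrC; exact: wl.
move=> [[Ex xmu] xk] [[Ey ymu] yk].
have [/andP[x0 _] [_ _ _ irrx]] := Ex; have [/andP[y0 y1] [_ _ _ irry]] := Ey.
rewrite distrC ger0_norm ?subr_ge0//.
apply: le_trans (parameter_gap x0 xy y1 hb irrx irry _) _.
  by apply: floor_sum_inj; [exact: rho0|exact: rho0|exact: etrans xk (esym yk)].
rewrite mulrC ler_pM2l ?invr_gt0//.
(* [parameter_gap] yields the power [N.+1]; one factor [y <= 1] is dropped before comparing with
   [mu m ^+ N]. *)
apply: (@le_trans _ _ (y ^+ N)); first by rewrite ler_wiXn2l ?ltW.
have /andP[mu0 _] := mu01.
by rewrite lerXn2r ?nnegrE// ltW.
Qed.
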